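(* Let $M$ be a 1-cusped hyperbolic 3-manifold with an epimorphism $\alpha:\pi_1(M)\twoheadrightarrow\mathbb{Z}$ and an ideal triangulation $\mathcal{T}$ admitting a geometric solution, and let $\sigma$ be an obstruction cocycle. Then $$\tau^{\mathrm{CS}}(\mathcal{T},t)=\pm\frac{1}{c_1\cdots c_N}\det\left(\frac{\partial p^\sigma_i}{\partial c_j}\right),\qquad 1\le i,j\le N+L,$$ where the right-hand side is evaluated at a point $(c_1,\dots,c_{N+L})\in(\mathbb{C}^* )^{N+L}$ corresponding to the geometric solution of $\mathcal{T}$.
   Context: **Twisted 1-loop invariant.** $M$ is oriented; $\mathcal{T}$ has edges $e_1,\dots,e_N$ and tetrahedra $\Delta_1,\dots,\Delta_N$. Let $\widetilde M$ be the infinite cyclic cover corresponding to $\ker\alpha$, with lifted triangulation $\widetilde{\mathcal{T}}$ and generator $g$ of the deck group $\mathbb{Z}$. Choose a fundamental domain, giving lifts $\widetilde e_i,\widetilde\Delta_j$ ($1\le i,j\le N$); the same choice is used on both sides of the claim. Choose for each $\Delta_j$ a pair of opposite edges (quad type); assign $z_j$ to that pair and $z_j'=\frac1{1-z_j}$, $z_j''=1-\frac1{z_j}$ to the other two pairs of opposite edges, in the cyclic order around each ideal vertex determined by the orientation (the usual cross-ratio convention), $z_j\in\mathbb{C}\setminus\{0,1\}$. For $\square\in\{\ ,{}',{}''\}$, $\mathbf{G}^\square_k$ ($k\in\mathbb{Z}$) is the $N\times N$ matrix whose $(i,j)$-entry is the number of edges of $g^k\widetilde\Delta_j$ with parameter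 $z_j^\square$ incident to $\widetilde e_i$; $\mathbf{G}^\square(t)=\sum_k\mathbf{G}^\square_kt^k$ and $\mathbf{G}^\square=\mathbf{G}^\square(1)$. The gluing equation of $e_i$ is $\prod_jz_j^{\mathbf{G}_{ij}}z_j'^{\mathbf{G}'_{ij}}z_j''^{\mathbf{G}''_{ij}}=1$. Each peripheral curve $\gamma$ (oriented, homotopically non-trivial simple closed curve in the peripheral torus) has row vectors $\mathbf{C}_\gamma^\square\in\mathbb{Z}^N$ such that its completeness equation is $\prod_jz_j^{\mathbf{C}_{\gamma j}}z_j'^{\mathbf{C}'_{\gamma j}}z_j''^{\mathbf{C}''_{\gamma j}}=1$. A solution of $\mathcal{T}$ satisfies all gluing and completeness equations; it is geometric if its holonomy is the geometric representation $\pi_1(M)\to\mathrm{PSL}_2(\mathbb{C})$. A combinatorial flattening is a triple $f,f',f''\in\mathbb{Z}^N$ with $f+f'+f''=(1,\dots,1)^T$, $\mathbf{G}f+\mathbf{G}'f'+\mathbf{G}''f''=(2,\dots,2)^T$ and $\mathbf{C}_\gamma f+\mathbf{C}_\gamma'f'+\mathbf{C}_\gamma''f''=0$ for all $\gamma$; one always exists. With $\zeta_j=\frac1{z_j}$, $\zeta_j'=\frac1{1-z_j}$, $\zeta_j''=\frac1{z_j(z_j-1)}$, $$\tau^{\mathrm{CS}}(\mathcal{T},t)=\frac{\det\big(\mathbf{G}(t)\mathrm{diag}(\zeta)+\mathbf{G}'(t)\mathrm{diag}(\zeta')+\mathbf{G}''(t)\mathrm{diag}(\zeta'')\big)}{\prod_{j=1}^N\zeta_j^{f_j}\zeta_j'^{f_j'}\zeta_j''^{f_j''}}\in\mathbb{C}[t^{\pm1}]$$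 evaluated at the geometric solution. Over all choices it is well-defined up to units $\pm t^k$ of $\mathbb{Z}[t^{\pm1}]$. **$\sigma$-Ptolemy assignments.** Let $\overline M$ be the compact manifold with torus boundary whose interior is $M$; truncating the tetrahedra of $\mathcal{T}$ decomposes $\overline M$ into truncated tetrahedra whose triangular faces triangulate $\partial\overline M$. Edges of $\partial\overline M$ are called short-edges; $\mathcal{E}(X)$ is the set of oriented edges of $X$. A cocycle $\sigma:\mathcal{E}(\partial\overline M)\to\{\pm1\}$ satisfies $\sigma(-e)=\sigma(e)^{-1}$ and has product $1$ around each triangle; it induces a homomorphism $\sigma:\pi_1(\partial\overline M)\to\{\pm1\}$. It is an obstruction cocycle if for some lift $\rho:\pi_1(M)\to\mathrm{SL}_2(\mathbb{C})$ of the geometric representation, up to conjugation $\rho(\gamma)=\begin{pmatrix}\sigma(\gamma)&*\\0&\sigma(\gamma)^{-1}\end{pmatrix}$ for all $\gamma\in\pi_1(\partial\overline M)$. For a tetrahedron $\Delta=[v_0,v_1,v_2,v_3]$ (labelled compatibly with orientation), $l_{ij}$ is the oriented edge from $v_i$ to $v_j$ and $s_{ijk}$ is the oriented short-edge at $v_j$ from $l_{ij}$ to $l_{jk}$. Given $c:\mathcal{E}(\Delta)\to\mathbb{C}^*$ with $c(-e)=-c(e)$, the $\sigma$-Ptolemy equation of $\Delta$ is $$c(l_{02})c(l_{13})-\frac{\sigma(s_{031})\sigma(s_{302})}{\sigma(s_{312})\sigma(s_{021})}c(l_{03})c(l_{12})-\frac{\sigma(s_{013})\sigma(s_{102})}{\sigma(s_{132})\sigma(s_{023})}c(l_{01})c(l_{23})=0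 .$$ A $\sigma$-Ptolemy assignment of $\mathcal{T}$ is $c:\mathcal{E}(\mathcal{T})\to\mathbb{C}^*$ with $c(-e)=-c(e)$ satisfying this equation for all tetrahedra. It determines shape parameters: the shape parameter of $\Delta$ at $l_{13}$ (and $l_{02}$) is $z=-\frac{\sigma(s_{103})\sigma(s_{321})}{\sigma(s_{032})\sigma(s_{210})}\frac{c(l_{01})c(l_{23})}{c(l_{03})c(l_{12})}$; with this quad type, $z'$ is at $l_{01},l_{23}$ and $z''$ at $l_{03},l_{12}$ (''compatibly with orientation'' means that this matches the convention above). These form a solution of $\mathcal{T}$; $c$ corresponds to the geometric solution if that solution is geometric. For an obstruction cocycle such a $c$ exists. **The functions $p_i^\sigma$.** Let $\widetilde e_{N+1},\dots,\widetilde e_{N+L}$ be the edges of $\widetilde\Delta_1,\dots,\widetilde\Delta_N$ other than $\widetilde e_1,\dots,\widetilde e_N$. For $N+1\le i\le N+L$ there are unique $1\le j(i)\le N$ and $k(i)\in\mathbb{Z}$ with $\widetilde e_i=g^{k(i)}\cdot\widetilde e_{j(i)}$. Orient the edges of $\mathcal{T}$, orient those of $\widetilde{\mathcal{T}}$ accordingly, and assign a variable $c_i$ to each $\widetilde e_i$, $1\le i\le N+L$. For $1\le i\le N$, $p_i^\sigma$ is the left-hand side of the $\sigma$-Ptolemy equation of $\widetilde\Delta_i$ in these variables; for $N+1\le i\le N+L$, $p_i^\sigma=c_i-t^{-k(i)}c_{j(i)}$. A $\sigma$-Ptolemy assignment $c$ of $\mathcal{T}$ gives the point $(c_1,\dots,c_{N+L})$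 with $c_i=c(e_i)$ for $i\le N$ and $c_i=c_{j(i)}$ for $i>N$; a point corresponds to the geometric solution if it arises in this way from such a $c$. *)

(* Defs.v *)
From HB Require Import structures.
From mathcomp Require Import all_boot all_order all_algebra all_fingroup.
From mathcomp Require Import complex.
From mathcomp Require Import boolp classical_sets functions fsbigop reals ereal.
From mathcomp Require Import topology normedtype derive.
From mathcomp Require Import measure lebesgue_measure lebesgue_integral.
From mathcomp Require mpoly.
Import (canonicals) mpoly.
From Stdlib Require Relation_Operators.

Set Implicit Arguments.
Unset Strict Implicit.
Unset Printing Implicit Defensive.

Import Order.TTheory GRing.Theory Num.Theory.
Import numFieldNormedType.Exports.
Local Open Scope ring_scope.

Definition v0 : 'I_4 := @Ordinal 4 0 isT.
Definition v1 : 'I_4 := @Ordinal 4 1 isT.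
Definition v2 : 'I_4 := @Ordinal 4 2 isT.
Definition v3 : 'I_4 := @Ordinal 4 3 isT.

(* Face f of a tetrahedron is the face opposite to vertex f.  Face f of
   tetrahedron j is glued to face [glue j f f] of tetrahedron [adj j f]; the
   permutation [glue j f] gives the gluing on the vertices v != f and sends f to
   the vertex opposite to the target face.  The vertex labellings are compatible
   with an orientation exactly when all these permutations are odd. *)
Record triangulation (N : nat) := Triangulation {
  adj : 'I_N -> 'I_4 -> 'I_N;
  glue : 'I_N -> 'I_4 -> 'S_4;
  adjK : forall j f, adj (adj j f) (glue j f f) = j;
  glueK : forall j f, glue (adj j f) (glue j f f) = ((glue j f)^-1)%g;
  glue_neq : forall j f, (adj j f, glue j f f) != (j, f);
  glue_odd : forall j f, odd_perm (glue j f) }.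

(* The oriented edge l_{vw} (v != w) of tetrahedron j, or the corner at the edge
   vw of the truncation triangle of j at its vertex v. *)
Definition slot (N : nat) := ('I_N * 'I_4 * 'I_4)%type.

Section Combinatorics.
Variables (N : nat) (T : triangulation N).

Definition is_slot (x : slot N) : bool := x.1.2 != x.2.
Definition rev_slot (x : slot N) : slot N := (x.1.1, x.2, x.1.2).
Definition cross (x : slot N) (f : 'I_4) : slot N :=
  (adj T x.1.1 f, glue T x.1.1 f x.1.2, glue T x.1.1 f x.2).
Definition on_face (x : slot N) (f : 'I_4) : bool := (f != x.1.2) && (f != x.2).

Definition slot_glued : rel (slot N) :=
  fun x y => [exists f, on_face x f && (y == cross x f)].

(* The classes of [connect slot_glued] on slots are both the oriented edges of
   the triangulation and the vertices of the boundary triangulation. *)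
Definition slot_class (x : slot N) : {set slot N} :=
  [set y | connect slot_glued x y].

Definition link_vertices : {set {set slot N}} :=
  [set slot_class x | x in [set x | is_slot x]].
(* pairs of glued sides of truncation triangles, a side being a triple
   (tetrahedron, vertex, face through that vertex) *)
Definition link_edges : {set {set slot N}} :=
  [set [set x; (adj T x.1.1 x.2, glue T x.1.1 x.2 x.1.2, glue T x.1.1 x.2 x.2)]
     | x in [set x | is_slot x]].
Definition link_euler : int :=
  #|link_vertices|%:Z - #|link_edges|%:Z + #|[set: 'I_N * 'I_4]|%:Z.

Definition link_adjacent : rel ('I_N * 'I_4) :=
  fun x y => [exists f, (f != x.2) && (y == (adj T x.1 f, glue T x.1 f x.2))].

(* The boundary of the truncated manifold is one closed connected (oriented)
   surface of Euler characteristic 0. *)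
Definition one_torus_cusp : Prop :=
  (forall x y, connect link_adjacent x y) /\ link_euler = 0.

(* A path in M is recorded, up to homotopy, by its initial tetrahedron and the
   sequence of faces through which it leaves the successive tetrahedra. *)
Definition path_end (j : 'I_N) (p : seq 'I_4) : 'I_N := foldl (adj T) j p.

Definition is_loop (j : 'I_N) (p : seq 'I_4) : Prop := path_end j p = j.

(* walks around a fixed oriented edge *)
Inductive edge_walk : slot N -> slot N -> seq 'I_4 -> Prop :=
| edge_walk_nil x : edge_walk x x [::]
| edge_walk_cons x y f p :
    on_face x f -> edge_walk (cross x f) y p -> edge_walk x y (f :: p).

(* Removal of a subpath that walks around an edge and comes back to its starting
   slot; this includes backtracking through a face. *)
Definition elementary_homotopy (j : 'I_N) (p q : seq 'I_4) : Prop :=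
  exists u l r v w, [/\ v != w, p = u ++ l ++ r, q = u ++ r &
    edge_walk (path_end j u, v, w) (path_end j u, v, w) l].

Definition homotopic (j : 'I_N) : seq 'I_4 -> seq 'I_4 -> Prop :=
  Relation_Operators.clos_refl_sym_trans _ (elementary_homotopy j).

(* morphisms from pi_1(M, j) to (G, mulG) with elements taken modulo eqG *)
Definition pi1_morphism (j : 'I_N) (G : Type) (eqG : G -> G -> Prop)
    (mulG : G -> G -> G) (phi : seq 'I_4 -> G) : Prop :=
  (forall p q, is_loop j p -> is_loop j q ->
     eqG (phi (p ++ q)) (mulG (phi p) (phi q))) /\
  (forall p q, is_loop j p -> homotopic j p q -> eqG (phi p) (phi q)).

Definition pi1_epi_int (j : 'I_N) (alpha : seq 'I_4 -> int) : Prop :=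
  pi1_morphism j eq +%R alpha /\
  forall n : int, exists2 p, is_loop j p & alpha p = n.

(* Paths in the boundary torus, in the 1-skeleton of the boundary triangulation:
   [boundary_path sigma x y p s] goes from corner x to corner y, runs through the
   faces p as a path of M, and has s as product of the values of sigma over its
   short-edges; [sigma j a v b] stands for sigma(s_{avb}) in tetrahedron j. *)
Inductive boundary_path (sigma : 'I_N -> 'I_4 -> 'I_4 -> 'I_4 -> int) :
    slot N -> slot N -> seq 'I_4 -> int -> Prop :=
| boundary_path_nil x : boundary_path sigma x x [::] 1
| boundary_path_short j v a b y p s :
    uniq [:: a; v; b] -> boundary_path sigma (j, v, b) y p s ->
    boundary_path sigma (j, v, a) y p (sigma j a v b * s)
| boundary_path_glue x y f p s :
    on_face x f -> boundary_path sigma (cross x f) y p s ->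
    boundary_path sigma x y (f :: p) s.

(* An arc (j, s) crosses the truncation triangle of tetrahedron j at vertex s 0,
   from its side on face s 1 to its side on face s 2; it cuts off the corner at
   the edge joining s 0 and s 3.  The parity of s tells on which side of the arc
   this corner lies. *)
Definition arc := ('I_N * 'S_4)%type.

Definition arc_follows (x y : arc) : Prop :=
  [/\ y.1 = adj T x.1 (x.2 v2), y.2 v0 = glue T x.1 (x.2 v2) (x.2 v0) &
      y.2 v1 = glue T x.1 (x.2 v2) (x.2 v2)].

Definition closed_curve n (gamma : 'I_n.+1 -> arc) : Prop :=
  forall m, arc_follows (gamma m) (gamma (ordS m)).

(* [d m f] is the distance, along a side of length 1, from the corner cut off by
   the m-th arc to the end point of this arc on the side f.  The arcs, drawn as
   straight chords, have to be pairwise disjoint. *)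
Definition simple_curve n (gamma : 'I_n.+1 -> arc) : Prop :=
  exists d : 'I_n.+1 -> 'I_4 -> rat,
  [/\ forall m f, 0 < d m f < 1,
      forall m, let x := gamma m in let y := gamma (ordS m) in
        d (ordS m) (y.2 v1) =
          if glue T x.1 (x.2 v2) (x.2 v3) == y.2 v3 then d m (x.2 v2)
          else 1 - d m (x.2 v2) &
      forall m m', let x := gamma m in let y := gamma m' in
        m != m' -> x.1 = y.1 -> x.2 v0 = y.2 v0 ->
        (x.2 v3 = y.2 v3 ->
           0 < (d m (x.2 v1) - d m' (x.2 v1)) *
               (d m (x.2 v2) - d m' (x.2 v2))) /\
        (forall f, uniq [:: f; x.2 v0; x.2 v3; y.2 v3] ->
           d m f + d m' f < 1)].

(* homotopy of paths in the boundary torus, starting in the triangle x *)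
Definition triangle_end (x : 'I_N * 'I_4) (p : seq 'I_4) : 'I_N * 'I_4 :=
  foldl (fun y f => (adj T y.1 f, glue T y.1 f y.2)) x p.

Definition boundary_elementary_homotopy (x : 'I_N * 'I_4) (p q : seq 'I_4) :=
  exists u l r w, let y := triangle_end x u in
  [/\ y.2 != w, p = u ++ l ++ r, q = u ++ r &
      edge_walk (y.1, y.2, w) (y.1, y.2, w) l].

Definition boundary_homotopic (x : 'I_N * 'I_4) : seq 'I_4 -> seq 'I_4 -> Prop :=
  Relation_Operators.clos_refl_sym_trans _ (boundary_elementary_homotopy x).

Definition essential_curve n (gamma : 'I_n.+1 -> arc) : Prop :=
  let x := gamma ord0 in
  ~ boundary_homotopic (x.1, x.2 v0)
      [seq (gamma m).2 v2 | m <- enum 'I_n.+1] [::].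

Definition peripheral_curve n (gamma : 'I_n.+1 -> arc) : Prop :=
  [/\ closed_curve gamma, simple_curve gamma & essential_curve gamma].

(* A numbering e_1, ..., e_N and an orientation of the edges. *)
Record edge_labelling := EdgeLabelling {
  eidx : slot N -> 'I_N;
  edir : slot N -> bool;
  eidxP : forall x y, is_slot x -> is_slot y ->
    (eidx x = eidx y <->
     connect slot_glued x y \/ connect slot_glued (rev_slot x) y);
  eidx_surj : forall i, exists2 x, is_slot x & eidx x = i;
  edir_rev : forall x, is_slot x -> edir (rev_slot x) = ~~ edir x;
  edir_glued : forall x y, is_slot x -> slot_glued x y -> edir y = edir x }.

(* Lifts tilde Delta_j and tilde e_i to the infinite cyclic cover.  Tetrahedra
   and edges of the cover are then g^n tilde Delta_j and g^n tilde e_i: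
   - the neighbour of tilde Delta_j across its face f is
     g^(tshift j f) tilde Delta_(adj j f);
   - the edge of tilde Delta_j at the slot (j, v, w) is
     g^(eshift (j, v, w)) tilde e_(eidx (j, v, w)). *)
Record cover_lifts := CoverLifts {
  tshift : 'I_N -> 'I_4 -> int;
  eshift : slot N -> int;
  tshiftK : forall j f, tshift (adj T j f) (glue T j f f) = - tshift j f;
  eshift_rev : forall x, is_slot x -> eshift (rev_slot x) = eshift x;
  eshift_cross : forall x f, is_slot x -> on_face x f ->
    eshift x = tshift x.1.1 f + eshift (cross x f) }.

Fixpoint path_shift (D : cover_lifts) (j : 'I_N) (p : seq 'I_4) : int :=
  if p is f :: p' then tshift D j f + path_shift D (adj T j f) p' else 0.

(* The monodromy of the cover is alpha, so that the cover corresponds to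
   ker alpha and g to 1. *)
Definition cover_of (j : 'I_N) (alpha : seq 'I_4 -> int) (D : cover_lifts) :=
  forall p, is_loop j p -> path_shift D j p = alpha p.

(* Enumeration of the edges g^k tilde e_j of tilde Delta_1, ..., tilde Delta_N
   which are not among tilde e_1, ..., tilde e_N, as pairs (j, k). *)
Record other_edges (E : edge_labelling) (D : cover_lifts) (L : nat) :=
  OtherEdges {
  other : 'I_L -> 'I_N * int;
  other_inj : injective other;
  otherP : forall jk : 'I_N * int, (exists l, other l = jk) <->
    jk.2 <> 0 /\ exists2 x, is_slot x & (eidx E x, eshift D x) = jk }.

(* The three pairs of opposite edges {02,13}, {01,23}, {03,12}, in the cyclic
   order induced at each vertex by the orientation. *)
Definition quad (v w : 'I_4) : 'Z_3 :=
  match val v, val w with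
  | 0%N, 2%N | 2%N, 0%N | 1%N, 3%N | 3%N, 1%N => 0
  | 0%N, 1%N | 1%N, 0%N | 2%N, 3%N | 3%N, 2%N => 1
  | _, _ => 2%:R
  end.

(* [q j] is the quad type carrying z_j; then z_j' and z_j'' are carried by
   q j + 1 and q j + 2.  The symbols [blank], ' and '' are 0, 1, 2 in 'Z_3. *)
Definition Gk (E : edge_labelling) (D : cover_lifts) (q : 'I_N -> 'Z_3)
    (b : 'Z_3) (k : int) (i j : 'I_N) : nat :=
  #|[set vw : 'I_4 * 'I_4 | [&& (vw.1 < vw.2)%N, quad vw.1 vw.2 == q j + b,
       eidx E (j, vw.1, vw.2) == i & k + eshift D (j, vw.1, vw.2) == 0]]|.

(* only finitely many k contribute *)
Definition Gt (E : edge_labelling) (D : cover_lifts) (q : 'I_N -> 'Z_3)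
    (K : comUnitRingType) (t : K) (b : 'Z_3) : 'M[K]_N :=
  \matrix_(i, j) \sum_(k \in [set: int]) ((Gk E D q b k i j)%:R * t ^ k).

Definition G (E : edge_labelling) (D : cover_lifts) (q : 'I_N -> 'Z_3)
    (b : 'Z_3) : 'M[int]_N := Gt E D q (1 : int) b.

Definition Cg (q : 'I_N -> 'Z_3) n (gamma : 'I_n.+1 -> arc) (b : 'Z_3) :
    'rV[int]_N :=
  \row_j \sum_(m | ((gamma m).1 == j) &&
                   (quad ((gamma m).2 v0) ((gamma m).2 v3) == q j + b))
           (-1) ^+ odd_perm (gamma m).2.

Definition flattening (E : edge_labelling) (D : cover_lifts)
    (q : 'I_N -> 'Z_3) (f : 'Z_3 -> 'cV[int]_N) : Prop :=
  [/\ \sum_b f b = const_mx 1,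
      \sum_b G E D q b *m f b = const_mx 2%:R &
      forall n (gamma : 'I_n.+1 -> arc), peripheral_curve gamma ->
        \sum_b Cg q gamma b *m f b = 0].

End Combinatorics.

Section Hyperbolic.
Variable R : realType.
Local Notation C := (R[i])%C.

(* upper half-space, with its standard orientation as a subset of R^3 *)
Definition height (P : 'rV[R]_3) : R := P 0 2%:R.
Definition horiz (P : 'rV[R]_3) : C := Complex (P 0 0) (P 0 1).
Definition point3 (x y h : R) : 'rV[R]_3 := \row_i [:: x; y; h]`_i.

Definition H3 : set 'rV[R]_3 := [set P | 0 < height P]%classic.

(* action of SL_2(C) by Poincare extension of Moebius transformations *)
Definition mobius (A : 'M[C]_2) (P : 'rV[R]_3) : 'rV[R]_3 :=
  let a := A 0 0 in let b := A 0 1 in let c := A 1 0 in let d := A 1 1 in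
  let z := horiz P in let h := height P in
  let den : R := complex.Re ((c * z + d) * conjc (c * z + d) + c * conjc c * (h ^+ 2)%:C%C) in
  let num : C := (a * z + b) * conjc (c * z + d) + a * conjc c * (h ^+ 2)%:C%C in
  point3 (complex.Re num / den) (complex.Im num / den) (h / den).

Definition eq_PSL2 (A B : 'M[C]_2) : Prop := A = B \/ A = - B.

(* barycentric coordinates in the simplex with vertices 0, e_1, e_2, e_3 *)
Definition bary (x : 'rV[R]_3) (v : 'I_4) : R :=
  if unlift ord0 v is Some i then x 0 i else 1 - \sum_i x 0 i.

Definition ideal_simplex : set 'rV[R]_3 :=
  [set x | forall v, 0 <= bary x v < 1]%classic.
Definition open_simplex : set 'rV[R]_3 :=
  [set x | forall v, 0 < bary x v]%classic.

Definition hyperbolic_volume (F : set (R * R * R)) : \bar R :=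
  (\int[(@lebesgue_measure R \x @lebesgue_measure R) \x @lebesgue_measure R]_(u in F)
     ((u.2 ^+ 3)^-1)%:E)%E.

Variables (N : nat) (T : triangulation N) (j0 : 'I_N).

(* The universal cover of M, based at the tetrahedron j0, is glued from one copy
   of the ideal simplex for each homotopy class of paths starting at j0. *)
Definition glued_points (j : 'I_N) (f : 'I_4) (x y : 'rV[R]_3) : Prop :=
  [/\ x \in ideal_simplex, y \in ideal_simplex, bary x f = 0 &
      forall v, bary y (glue T j f v) = bary x v].

Inductive same_point : seq 'I_4 * 'rV[R]_3 -> seq 'I_4 * 'rV[R]_3 -> Prop :=
| same_homotopic p q x : homotopic T j0 p q -> same_point (p, x) (q, x)
| same_glued p f x y :
    glued_points (path_end T j0 p) f x y -> same_point (p, x) (rcons p f, y)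
| same_sym u v : same_point u v -> same_point v u
| same_trans u v w : same_point u v -> same_point v w -> same_point u w.

(* D induces an orientation preserving homeomorphism from the universal cover of
   M onto H^3 that is rho-equivariant.  The condition on U says that the bijection
   is a homeomorphism for the quotient topology.  The condition on the Jacobian
   takes the simplex 0, e_1, e_2, e_3 as positively oriented; with that convention
   {13,02}, {23,01}, {03,12} is the cyclic order of [quad]. *)
Definition developing_homeo (rho : seq 'I_4 -> 'M[C]_2)
    (D : seq 'I_4 -> 'rV[R]_3 -> 'rV[R]_3) : Prop :=
  [/\ (forall p x, x \in ideal_simplex -> D p x \in H3) /\
      (forall P, P \in H3 -> exists p x, x \in ideal_simplex /\ D p x = P),
      (forall p q x y, x \in ideal_simplex -> y \in ideal_simplex ->
         (D p x = D q y <-> same_point (p, x) (q, y))),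
      (forall U : set 'rV[R]_3, (U `<=` H3)%classic ->
         (open U <-> forall p, exists V : set 'rV[R]_3, open V /\
            forall x, x \in ideal_simplex -> (x \in V <-> D p x \in U))),
      (forall p x, x \in open_simplex ->
         differentiable (D p) x /\ 0 < \det ('J (D p) x)) &
      (forall p q x, is_loop T j0 p -> x \in ideal_simplex ->
         D (p ++ q) x = mobius (rho p) (D q x))].

Definition finite_covolume (rho : seq 'I_4 -> 'M[C]_2) : Prop :=
  exists F : set (R * R * R), [/\ measurable F,
    (hyperbolic_volume F < +oo)%E,
    (forall u, u \in F -> 0 < u.2) &
    forall P, P \in H3 -> exists p u, [/\ is_loop T j0 p, u \in F &
      P = mobius (rho p) (point3 u.1.1 u.1.2 u.2)]].

(* rho : pi_1(M, j0) -> PSL_2(C), given by matrices of determinant 1 up to sign,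
   is the holonomy of a complete hyperbolic structure of finite volume on M. *)
Definition geometric_rep (rho : seq 'I_4 -> 'M[C]_2) : Prop :=
  [/\ forall p, is_loop T j0 p -> \det (rho p) = 1,
      pi1_morphism T j0 eq_PSL2 mulmx rho,
      finite_covolume rho &
      exists D, developing_homeo rho D].

Definition one_cusped_hyperbolic : Prop :=
  one_torus_cusp T /\ exists rho, geometric_rep rho.

(* z, z', z'' *)
Definition shape (z : C) (b : 'Z_3) : C :=
  match val b with 0%N => z | 1%N => (1 - z)^-1 | _ => 1 - z^-1 end.

Definition zeta (z : C) (b : 'Z_3) : C :=
  match val b with
  | 0%N => z^-1 | 1%N => (1 - z)^-1 | _ => (z * (z - 1))^-1
  end.

Variables (E : edge_labelling T) (D : cover_lifts T) (q : 'I_N -> 'Z_3).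

Definition solution (z : 'I_N -> C) : Prop :=
  [/\ forall j, z j != 0 /\ z j != 1,
      forall i, \prod_j \prod_b shape (z j) b ^ (G E D q b i j) = 1 &
      forall n (gamma : 'I_n.+1 -> arc N), peripheral_curve T gamma ->
        \prod_j \prod_b shape (z j) b ^ (Cg q gamma b 0 j) = 1].

(* Points of CP^1 are given by nonzero column vectors. *)
Definition wedge (x y : 'cV[C]_2) : C := x 0 0 * y 1 0 - x 1 0 * y 0 0.

(* [dev p v] is the developed image of the ideal vertex v of the last tetrahedron
   of p.  The parameter of l_13 is the cross-ratio
   (x0 - x1)(x2 - x3) / ((x2 - x1)(x0 - x3)); it is z for x1, x2, x0, x3 equal to
   0, 1, z, oo. *)
Definition holonomy (z : 'I_N -> C) (rho : seq 'I_4 -> 'M[C]_2) : Prop :=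
  exists dev : seq 'I_4 -> 'I_4 -> 'cV[C]_2,
  [/\ forall p v w, v != w -> wedge (dev p v) (dev p w) != 0,
      forall p q v, homotopic T j0 p q -> wedge (dev p v) (dev q v) = 0,
      forall p f v, v != f ->
        wedge (dev (rcons p f) (glue T (path_end T j0 p) f v)) (dev p v) = 0,
      forall p, let j := path_end T j0 p in let x := dev p in
        shape (z j) (0 - q j) =
          wedge (x v0) (x v1) * wedge (x v2) (x v3) /
          (wedge (x v2) (x v1) * wedge (x v0) (x v3)) &
      forall p r v, is_loop T j0 p ->
        wedge (dev (p ++ r) v) (rho p *m dev r v) = 0].

Definition geometric_solution (z : 'I_N -> C) : Prop :=
  solution z /\ exists2 rho, geometric_rep rho & holonomy z rho.

Variable sigma : 'I_N -> 'I_4 -> 'I_4 -> 'I_4 -> int.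

Definition short_edge_cocycle : Prop :=
  [/\ forall j a v b, uniq [:: a; v; b] ->
        sigma j a v b = 1 \/ sigma j a v b = -1,
      forall j a v b, uniq [:: a; v; b] -> sigma j b v a = (sigma j a v b)^-1,
      forall j a b c v, uniq [:: a; b; c; v] ->
        sigma j a v b * sigma j b v c * sigma j c v a = 1 &
      forall j a v b f, uniq [:: a; v; b; f] ->
        sigma (adj T j f) (glue T j f a) (glue T j f v) (glue T j f b) =
        sigma j a v b].

Definition obstruction_cocycle : Prop :=
  short_edge_cocycle /\
  exists rho : seq 'I_4 -> 'M[C]_2,
  [/\ geometric_rep rho, pi1_morphism T j0 eq mulmx rho &
      forall v a, v != a -> exists2 P : 'M[C]_2, P \in unitmx &
        forall p s, boundary_path T sigma (j0, v, a) (j0, v, a) p s ->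
          let B := invmx P *m rho p *m P in
          [/\ B 0 0 = s%:~R, B 1 0 = 0 & B 1 1 = (s%:~R)^-1]].

Section PtolemyPolynomial.
Variables (A : comNzRingType) (cst : int -> A) (c : 'I_4 -> 'I_4 -> A).

Definition ptolemy_lhs (j : 'I_N) : A :=
  let s a v b := sigma j a v b in
  c v0 v2 * c v1 v3
  - cst ((s v0 v3 v1 * s v3 v0 v2) / (s v3 v1 v2 * s v0 v2 v1)) *
    (c v0 v3 * c v1 v2)
  - cst ((s v0 v1 v3 * s v1 v0 v2) / (s v1 v3 v2 * s v0 v2 v3)) *
    (c v0 v1 * c v2 v3).

End PtolemyPolynomial.

Definition ptolemy_assignment (c : slot N -> C) : Prop :=
  [/\ forall x, is_slot x -> c x != 0,
      forall x, is_slot x -> c (rev_slot x) = - c x,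
      forall x y, is_slot x -> slot_glued T x y -> c y = c x &
      forall j, ptolemy_lhs intr (fun v w => c (j, v, w)) j = 0].

Definition ptolemy_shape (c : slot N -> C) (j : 'I_N) : C :=
  let s a v b := (sigma j a v b)%:~R : C in
  - ((s v1 v0 v3 * s v3 v2 v1) / (s v0 v3 v2 * s v2 v1 v0)) *
    ((c (j, v0, v1) * c (j, v2, v3)) / (c (j, v0, v3) * c (j, v1, v2))).

(* c determines the shape parameters z: the left-hand side is the parameter of
   the edges l_02 and l_13 *)
Definition has_shapes (c : slot N -> C) (z : 'I_N -> C) : Prop :=
  forall j, shape (z j) (0 - q j) = ptolemy_shape c j.

(* Laurent polynomials in t are taken in the field of rational functions. *)
Local Notation Ct := {fraction {poly C}}.

Definition tvar : Ct := FracField.tofrac 'X.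
Definition Cconst (a : C) : Ct := FracField.tofrac a%:P.

Variables (L : nat) (O : other_edges E D L).

(* the variable of the edge of tilde Delta_j at the slot x = (j, v, w) *)
Definition edge_var (x : slot N) : 'I_(N + L) :=
  if [pick l | other O l == (eidx E x, eshift D x)] is Some l then rshift N l
  else lshift L (eidx E x).

Local Notation Pol := (mpoly.mpoly (N + L) Ct).
Local Notation X i := (mpoly.mpolyX Ct (mpoly.mnm1 i) : Pol).

Definition edge_poly (x : slot N) : Pol :=
  (-1) ^+ (~~ edir E x) * X (edge_var x).

Definition p_sigma (i : 'I_(N + L)) : Pol :=
  match fintype.split i with
  | inl j => ptolemy_lhs intr (fun v w => edge_poly (j, v, w)) j
  | inr l => X i - mpoly.mpolyC (N + L) (tvar ^ (- (other O l).2)) *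
                   X (lshift L (other O l).1)
  end.

(* the point of (C^* )^(N + L) given by a sigma-Ptolemy assignment *)
Definition point_of (c : slot N -> C) (pt : 'I_(N + L) -> C) : Prop :=
  (forall x, is_slot x -> edir E x -> pt (lshift L (eidx E x)) = c x) /\
  (forall l, pt (rshift N l) = pt (lshift L (other O l).1)).

Definition jacobian_det (pt : 'I_(N + L) -> C) : Ct :=
  \det (\matrix_(i, j)
    mpoly.meval (fun k => Cconst (pt k)) (mpoly.mderiv j (p_sigma i))).

Definition tau_CS (z : 'I_N -> C) (f : 'Z_3 -> 'cV[int]_N) : Ct :=
  \det (\sum_b Gt E D q tvar b *m diag_mx (\row_j Cconst (zeta (z j) b))) /
  Cconst (\prod_j \prod_b zeta (z j) b ^ (f b j 0)).

End Hyperbolic.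

(* Main.v *)
(* Scaling the k-th column of the Jacobian by c_k turns its first N rows into
   counts of edges of each quad type weighted by the three monomials of the
   Ptolemy equation, while the last L rows substitute t^(-k(i)) c_j(i) for the
   redundant variables; the determinant is thus that of G(t)w + G'(t)w' + G''(t)w''
   up to a power product of the c_i.  By the Ptolemy equation, the monomials of
   the j-th tetrahedron are lambda_j (zeta_j, zeta_j', zeta_j''), and evaluating
   prod w^f w'^f' w''^f'' with the flattening equations f + f' + f'' = 1 and
   Gf + G'f' + G''f'' = 2 gives prod lambda_j zeta^f zeta'^f' zeta''^f'' =
   +-(c_1 ... c_N)^2. *)
Require Import Defs.
From HB Require Import structures.
From mathcomp Require Import all_boot all_order all_algebra all_fingroup.
From mathcomp Require Import complex reals.
From mathcomp Require Import ring.
From mathcomp Require classical_sets fsbigop.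
From mathcomp Require mpoly.
Import (canonicals) mpoly.

Set Implicit Arguments.
Unset Strict Implicit.
Unset Printing Implicit Defensive.

Import GRing.Theory Num.Theory.
Local Open Scope ring_scope.

(** * Quad types, their pairs of opposite edges, and the entries of G(t) *)

Lemma Z3_cases (P : 'Z_3 -> Prop) : P 0 -> P 1 -> P 2%:R -> forall b, P b.
Proof.
move=> P0 P1 P2 [[|[|[|//]]] hb].
- by rewrite (_ : Ordinal hb = 0) //; apply: val_inj.
- by rewrite (_ : Ordinal hb = 1) //; apply: val_inj.
- by rewrite (_ : Ordinal hb = 2%:R) //; apply: val_inj.
Qed.

Lemma sum_Z3 (V : nmodType) (F : 'Z_3 -> V) :
  \sum_b F b = F 0 + F 1 + F 2%:R.
Proof.
rewrite !big_ord_recl big_ord0 addr0 addrA.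
by congr (F _ + F _ + F _); apply: val_inj.
Qed.

Definition quad_edges (k : 'Z_3) : seq ('I_4 * 'I_4) :=
  match val k with
  | 0%N => [:: (v0, v2); (v1, v3)]
  | 1%N => [:: (v0, v1); (v2, v3)]
  | _ => [:: (v0, v3); (v1, v2)]
  end.

Lemma quad_edges_uniq k : uniq (quad_edges k).
Proof. by elim/Z3_cases: k. Qed.

Lemma mem_quad_edges k (x : 'I_4 * 'I_4) :
  (x \in quad_edges k) = (x.1 < x.2)%N && (quad x.1 x.2 == k).
Proof.
case: x => v w; elim/Z3_cases: k;
  case: v => [[|[|[|[|//]]]] hv]; case: w => [[|[|[|[|//]]]] hw];
  by rewrite !inE -!pair_eqE.
Qed.

Lemma quad_edges_slot N k (x : 'I_4 * 'I_4) (j : 'I_N) :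
  x \in quad_edges k -> is_slot (j, x.1, x.2).
Proof.
by rewrite mem_quad_edges => /andP[lt_x _]; rewrite /is_slot -val_eqE /= ltn_eqF.
Qed.

(** The edge of g^k tilde Delta_j at a slot x over e_i is g^(k + [eshift D x]) tilde e_i. It equals
    tilde e_i for exactly one k, namely - [eshift D x], so each slot contributes a single power of
    t. *)
Lemma GtE N (T : triangulation N) (E : edge_labelling T) (D : cover_lifts T)
    (q : 'I_N -> 'Z_3) (K : comUnitRingType) (t : K) b i j :
  Gt E D q t b i j =
  \sum_(x <- quad_edges (q j + b) | eidx E (j, x.1, x.2) == i)
     t ^ (- eshift D (j, x.1, x.2)).
Proof.
rewrite mxE.
pose sh (x : 'I_4 * 'I_4) : int := - eshift D (j, x.1, x.2).
pose e := [seq x <- quad_edges (q j + b) | eidx E (j, x.1, x.2) == i].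
have ue : uniq e by rewrite filter_uniq ?quad_edges_uniq.
have GkE k : Gk E D q b k i j = size [seq x <- e | sh x == k].
  rewrite -(card_uniqP (filter_uniq _ ue)) /Gk; apply: eq_card => x.
  rewrite !inE !mem_filter mem_quad_edges addr_eq0 [sh x == k]eq_sym.
  by rewrite andbA andbC [X in X && _]andbC -andbA.
have GkX k : (Gk E D q b k i j)%:R * t ^ k = \sum_(x <- e | sh x == k) t ^ sh x.
  rewrite GkE -sum1_size natr_sum big_filter mulr_suml.
  by apply: eq_bigr => x /eqP ->; rewrite mul1r.
(* The sum over all integers is cut down to the finitely many exponents that occur; the count
   vanishes at any other k. *)
rewrite (fsbigop.fsbigE (undup (map sh e))) ?undup_uniq //=; last first.
  move=> k _; rewrite GkX mem_undup => /mapP k_notin.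
  rewrite big_seq_cond big1 // => x /andP[xe /eqP shx].
  by case: k_notin; exists x.
under eq_bigl => k do rewrite classical_sets.in_setT.
rewrite (eq_bigr _ (fun k _ => GkX k)) (exchange_big_dep predT) //=.
rewrite -[RHS]big_filter -/e.
rewrite [LHS]big_seq [RHS]big_seq; apply: eq_bigr => x xe.
under eq_bigl => k do rewrite eq_sym.
rewrite big_mkcond (bigD1_seq (sh x)) ?undup_uniq ?mem_undup ?map_f //=.
by rewrite eqxx big1 ?addr0 // => k /negPf->.
Qed.

(** * Monomials of the Ptolemy equation and shape parameters *)

Section PtolemyTerms.
Variables (N : nat) (sigma : 'I_N -> 'I_4 -> 'I_4 -> 'I_4 -> int).

(** The minus signs of the Ptolemy equation are absorbed here, so that it becomes a symmetric sum of
    three terms, one for each quad type. *)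
Definition ptolemy_coef (j : 'I_N) (k : 'Z_3) : int :=
  let s a v b := sigma j a v b in
  match val k with
  | 0%N => 1
  | 1%N => - ((s v0 v1 v3 * s v1 v0 v2) / (s v1 v3 v2 * s v0 v2 v3))
  | _ => - ((s v0 v3 v1 * s v3 v0 v2) / (s v3 v1 v2 * s v0 v2 v1))
  end.

Definition ptolemy_term (A : comNzRingType) (c : 'I_4 -> 'I_4 -> A) j k : A :=
  (ptolemy_coef j k)%:~R * \prod_(x <- quad_edges k) c x.1 x.2.

Lemma ptolemy_lhsE (A : comNzRingType) (c : 'I_4 -> 'I_4 -> A) j :
  ptolemy_lhs sigma intr c j = \sum_k ptolemy_term c j k.
Proof.
rewrite sum_Z3 /ptolemy_lhs /ptolemy_term /quad_edges /ptolemy_coef /=.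
by rewrite !big_cons !big_nil /= !mulr1 !mulrNz mulr1z; ring.
Qed.

Lemma ptolemy_coef_sign (T : triangulation N) j k :
  short_edge_cocycle T sigma -> ptolemy_coef j k ^+ 2 = 1.
Proof.
case=> sgn _ _ _.
have sq a v b : uniq [:: a; v; b] -> sigma j a v b ^+ 2 = 1.
  by move/sgn => /(_ j)[] ->.
have sqV x y z w : x ^+ 2 = 1 -> y ^+ 2 = 1 -> z ^+ 2 = 1 -> w ^+ 2 = 1 ->
    (- ((x * y) / (z * w)) : int) ^+ 2 = 1.
  move=> x1 y1 z1 w1.
  by rewrite sqrrN exprMn exprVn !exprMn x1 y1 z1 w1 !mulr1 invr1.
elim/Z3_cases: k; rewrite /ptolemy_coef.
- exact: expr1n.
- by apply: sqV; apply: sq.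
- by apply: sqV; apply: sq.
Qed.

(** At each vertex of the tetrahedron, the three sides of the truncation triangle are distributed
    one each to the shape parameter, to the coefficient of quad type 1 and to that of quad type 2.
    Since signs are their own inverses, the cocycle relation makes each the product of the other
    two. *)
Lemma ptolemy_shapeE (R : realType) (T : triangulation N)
    (c : slot N -> R[i]%C) j :
  short_edge_cocycle T sigma -> (forall x, is_slot x -> c x != 0) ->
  ptolemy_shape sigma c j =
  - (ptolemy_term (fun v w => c (j, v, w)) j 1 /
     ptolemy_term (fun v w => c (j, v, w)) j 2%:R).
Proof.
case=> sgn sym cyc _ c0.
have inv a v b : uniq [:: a; v; b] -> (sigma j a v b)^-1 = sigma j a v b.
  by move/sgn => /(_ j)[] ->; rewrite ?invr1 ?invrN1.
have sq a v b : uniq [:: a; v; b] -> sigma j a v b ^+ 2 = 1.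
  by move/sgn => /(_ j)[] ->.
have swap a v b : uniq [:: a; v; b] -> sigma j b v a = sigma j a v b.
  by move=> u; rewrite sym // inv.
have tri a b c' v : uniq [:: a; b; c'; v] -> uniq [:: a; v; c'] ->
    sigma j a v c' = sigma j a v b * sigma j b v c'.
  move=> u u'; have := cyc j a b c' v u; rewrite (swap _ _ _ u').
  case: (sgn j _ _ _ u') => ->; first by rewrite mulr1.
  by rewrite mulrN1 => <-; rewrite opprK.
have sqC a v b : uniq [:: a; v; b] -> (sigma j a v b)%:~R ^+ 2 = 1 :> R[i]%C.
  by move=> u; rewrite -rmorphXn /= sq.
have sgn0 a v b : uniq [:: a; v; b] -> (sigma j a v b)%:~R != 0 :> R[i]%C.
  by move/sqC => h; rewrite -sqrf_eq0 h oner_eq0.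
have divC a v b a' v' b' : uniq [:: a; v; b] -> uniq [:: a'; v'; b'] ->
    (sigma j a v b * sigma j a' v' b')^-1 = sigma j a v b * sigma j a' v' b'.
  by case/(sgn j) => ->; case/(sgn j) => ->;
    rewrite ?mulN1r ?mul1r ?opprK ?invr1 ?invrN1.
have k1 : ptolemy_coef j 1 = - (sigma j v0 v1 v3 * sigma j v1 v0 v2 *
    (sigma j v1 v3 v2 * sigma j v0 v2 v3)).
  by rewrite /ptolemy_coef /= divC.
have k2 : ptolemy_coef j 2%:R = - (sigma j v0 v3 v1 * sigma j v3 v0 v2 *
    (sigma j v3 v1 v2 * sigma j v0 v2 v1)).
  by rewrite /ptolemy_coef /= divC.
rewrite /ptolemy_term k1 k2 /ptolemy_shape !big_cons !big_nil /=.
rewrite (tri v1 v2 v3 v0) // (tri v3 v0 v1 v2) // (tri v0 v1 v2 v3) //.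
rewrite (tri v2 v3 v0 v1) // (swap v3 v0 v2) // (swap v0 v2 v3) //.
rewrite (swap v3 v1 v2) // (swap v0 v1 v3) // !(rmorphM, rmorphN) /=.
pose s a v b := (sigma j a v b)%:~R : R[i]%C; rewrite -!/(s _ _ _).
pose r := - (s v1 v0 v2 * s v0 v2 v3 * (c (j, v0, v1) * c (j, v2, v3)) /
  (s v3 v0 v2 * s v0 v2 v1 * s v0 v3 v1 * s v3 v1 v2 * s v0 v1 v3 *
   s v1 v3 v2 * (c (j, v0, v3) * c (j, v1, v2)))).
have s0 a v b : uniq [:: a; v; b] -> s a v b != 0 by exact: sgn0.
(* Both sides are r times squares of signs. *)
transitivity (r * (s v3 v0 v2 ^+ 2 * s v0 v2 v1 ^+ 2)).
  by rewrite /r; field; rewrite ?s0 ?c0.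
transitivity (r * (s v0 v1 v3 ^+ 2 * s v1 v3 v2 ^+ 2)); first by rewrite !sqC.
by rewrite /r; field; rewrite ?s0 ?c0.
Qed.

End PtolemyTerms.

(** The vanishing sum and the ratio of [w 1] to [w 2%:R] determine the three values up to scale, and
    zeta, zeta', zeta'' placed at q, q + 1, q + 2 satisfy the same two relations. The scale
    [w q * z] is forced by b = 0, where zeta is 1/z. The index [0 - q] appears because quad type 0
    is q + (0 - q). *)
Lemma zeta_quad (R : realType) (w : 'Z_3 -> R[i]%C) (z : R[i]%C) (q b : 'Z_3) :
  (forall k, w k != 0) -> \sum_k w k = 0 -> z != 0 -> z != 1 ->
  Defs.shape z (0 - q) = - (w 1 / w 2%:R) ->
  w (q + b) = w q * z * zeta z b.
Proof.
move=> w0; rewrite sum_Z3 => /eqP; rewrite -addrA addr_eq0 => /eqP sum0 z0 z1.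
have z1' : 1 - z != 0 by rewrite subr_eq0 eq_sym.
have z1'' : z - 1 != 0 by rewrite subr_eq0.
have w2 := w0 2%:R.
move=> hz; have w1 : w 1 = - w 2%:R * Defs.shape z (0 - q) by rewrite hz; field.
have w0E : w 0 = w 2%:R * (Defs.shape z (0 - q) - 1) by rewrite sum0 w1; ring.
have add11 : 1 + 1 = 2%:R :> 'Z_3 by apply: val_inj.
have add12 : 1 + 2%:R = 0 :> 'Z_3 by apply: val_inj.
have add21 : 2%:R + 1 = 0 :> 'Z_3 by apply: val_inj.
have add22 : 2%:R + 2%:R = 1 :> 'Z_3 by apply: val_inj.
clear hz sum0.
elim/Z3_cases: q w1 w0E => w1 w0E; rewrite /Defs.shape /= in w1 w0E;
  elim/Z3_cases: b; rewrite /zeta /=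
    ?addr0 ?add0r ?add11 ?add12 ?add21 ?add22 ?w1 ?w0E;
  by field; rewrite ?z0 ?z1' ?z1''.
Qed.

(** * The Jacobian matrix at the given point, over the rational functions in t *)

Lemma mderivXU n (A : comNzRingType) (i k : 'I_n) :
  mpoly.mderiv i (mpoly.mpolyX A (mpoly.mnm1 k)) = (k == i)%:R.
Proof.
rewrite mpoly.mderivX mpoly.mnm1E; case: eqP => [->|_]; last by rewrite scale0r.
rewrite scale1r -mpoly.mpolyX0; congr mpoly.mpolyX.
by apply/mpoly.mnmP => l; rewrite mpoly.mnmBE mpoly.mnm0E subnn.
Qed.

Lemma mderiv_intr n (A : comNzRingType) (i : 'I_n) (m : int) :
  mpoly.mderiv i (m%:~R : mpoly.mpoly n A) = 0.
Proof. by rewrite raddfMz /= -mpoly.mpolyC1 mpoly.mderivC mul0rz. Qed.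

Lemma Cconst_rmorphism (R : realType) :
  zmod_morphism (@Cconst R) * monoid_morphism (@Cconst R).
Proof.
split; first by move=> a b; rewrite /Cconst polyCB rmorphB.
by split=> [|a b]; rewrite /Cconst ?polyCM ?rmorphM ?rmorph1.
Qed.

HB.instance Definition _ (R : realType) :=
  GRing.isZmodMorphism.Build _ _ (@Cconst R) (Cconst_rmorphism R).1.
HB.instance Definition _ (R : realType) :=
  GRing.isMonoidMorphism.Build _ _ (@Cconst R) (Cconst_rmorphism R).2.

Section Evaluation.
Variables (R : realType) (N : nat) (T : triangulation N).
Variables (E : edge_labelling T) (D : cover_lifts T).
Variables (L : nat) (O : other_edges E D L).
Variables (sigma : 'I_N -> 'I_4 -> 'I_4 -> 'I_4 -> int).
Variables (c : slot N -> R[i]%C) (hc : ptolemy_assignment T sigma c).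
Variables (pt : 'I_(N + L) -> R[i]%C) (hpt : point_of O c pt).

Local Notation ev := (mpoly.meval (fun k => Cconst (pt k))).
Local Notation W j k :=
  (ptolemy_term sigma (fun v w => c (j, v, w)) j k).

Lemma pt_edge_var x : pt (edge_var O x) = pt (lshift L (eidx E x)).
Proof.
rewrite /edge_var; case: pickP => [l /eqP ol|//].
by rewrite (hpt.2 l) ol.
Qed.

Lemma assignment_pt x :
  is_slot x -> c x = (-1) ^+ (~~ edir E x) * pt (lshift L (eidx E x)).
Proof.
case: hc => _ c_rev _ _ sx; case: (boolP (edir E x)) => dx.
  by rewrite mul1r (hpt.1 x).
have srx : is_slot (rev_slot x) by rewrite /is_slot eq_sym.
have <- : eidx E (rev_slot x) = eidx E x.
  by apply/(eidxP E) => //; right; case: (x) => [[j v] w]; exact: connect0.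
rewrite (hpt.1 (rev_slot x)) ?edir_rev // c_rev //.
by rewrite mulN1r opprK.
Qed.

Lemma pt_neq0 i : pt (lshift L i) != 0.
Proof.
have [x sx <-] := eidx_surj E i; case: hc => c0 _ _ _.
by have := c0 x sx; rewrite assignment_pt // mulf_eq0 negb_or => /andP[].
Qed.

Lemma eval_edge_poly x : is_slot x -> ev (edge_poly R O x) = Cconst (c x).
Proof.
move=> sx; rewrite /edge_poly rmorphM rmorphXn rmorphN1 /= mpoly.mevalXU.
by rewrite pt_edge_var assignment_pt // rmorphM rmorphXn rmorphN1.
Qed.

(** Logarithmic form: the derivative is the value times an indicator over c_i. The orientation sign
    disappears into [c x], and the derivative of a monomial becomes the monomial times a sum over
    its edges. *)
Lemma eval_deriv_edge_poly i x : is_slot x ->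
  ev (mpoly.mderiv i (edge_poly R O x)) =
  Cconst (c x) * ((edge_var O x == i)%:R / Cconst (pt (lshift L (eidx E x)))).
Proof.
move=> sx; have ptx0 : Cconst (pt (lshift L (eidx E x))) != 0.
  by rewrite fmorph_eq0 pt_neq0.
rewrite assignment_pt // rmorphM rmorphXn rmorphN1 /edge_poly.
rewrite -[RHS]mulrA [X in _ = _ * X]mulrCA divff // mulr1.
case: (edir E x); rewrite ?mul1r ?mulN1r ?mpoly.mderivN ?mpoly.mevalN mderivXU;
  by rewrite rmorph_nat.
Qed.

Lemma eval_deriv_ptolemy_term i j k :
  ev (mpoly.mderiv i
        (ptolemy_term sigma (fun v w => edge_poly R O (j, v, w)) j k)) =
  \sum_(x <- quad_edges k)
    Cconst (W j k) *
    ((edge_var O (j, x.1, x.2) == i)%:R /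
     Cconst (pt (lshift L (eidx E (j, x.1, x.2))))).
Proof.
have slot_k x : x \in quad_edges k -> is_slot (j, x.1, x.2).
  exact: quad_edges_slot.
have [x [y kE]] : exists x y, quad_edges k = [:: x; y].
  by rewrite /quad_edges; case: (val k) => [|[|n]]; do 2!eexists.
rewrite /ptolemy_term kE !big_cons !big_nil !mulr1 addr0.
have sx : is_slot (j, x.1, x.2) by apply: slot_k; rewrite kE inE eqxx.
have sy : is_slot (j, y.1, y.2) by apply: slot_k; rewrite kE !inE eqxx orbT.
rewrite mpoly.mderivM mderiv_intr mul0r add0r mpoly.mderivM.
rewrite mpoly.mevalM mpoly.mevalD [ev (mpoly.mderiv _ _ * _)]mpoly.mevalM.
rewrite [ev (edge_poly _ _ _ * _)]mpoly.mevalM !eval_deriv_edge_poly //.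
rewrite !eval_edge_poly // !rmorphM !rmorph_int /=; ring.
Qed.

(** Substitution matrix of the redundant variables: row l expresses the l-th of them as t^(-k) c_j.
    It is minus the lower left block of the Jacobian. *)
Definition other_mx : 'M[{fraction {poly R[i]%C}}]_(L, N) :=
  \matrix_(l, m) (((other O l).1 == m)%:R * tvar R ^ (- (other O l).2)).

(** Either the edge has a redundant variable, whose row of [other_mx] supplies the power of t, or it
    is one of the chosen lifts, and then [otherP] forces its shift to be 0. *)
Lemma edge_var_other_mx m x : is_slot x ->
  (edge_var O x == lshift L m)%:R +
    \sum_(l < L) (edge_var O x == rshift N l)%:R * other_mx l m =
  (eidx E x == m)%:R * tvar R ^ (- eshift D x) :> {fraction {poly R[i]%C}}.
Proof.
move=> sx; rewrite /edge_var; case: pickP => [l /eqP ol | none].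
  rewrite eq_rlshift add0r (bigD1 l) //= eqxx mul1r mxE ol big1 ?addr0 // => l' ne.
  by rewrite eq_rshift eq_sym (negPf ne) mul0r.
rewrite eq_lshift big1 ?addr0 => [|l _]; last by rewrite eq_lrshift mul0r.
suff -> : eshift D x = 0 by rewrite oppr0 expr0z mulr1.
apply/eqP/negPn/negP => /eqP ne0.
have [l /eqP] := (otherP O (eidx E x, eshift D x)).2
  (conj ne0 (ex_intro2 _ _ x sx erefl)).
by rewrite none.
Qed.

Lemma jacobian_detE (q : 'I_N -> 'Z_3) :
  jacobian_det sigma O pt =
  (Cconst (\prod_(i < N) pt (lshift L i)))^-1 *
  \det (\sum_b Gt E D q (tvar R) b *m
          diag_mx (\row_j Cconst (W j (q j + b)))).
Proof.
rewrite /jacobian_det; set J := (X in \det X).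
(* A unipotent column operation: the lower blocks of [J] are [- other_mx] and the identity, so it
   clears the lower left block and leaves an N by N determinant. *)
have -> : \det J = \det (J *m block_mx 1%:M 0 other_mx 1%:M).
  by rewrite det_mulmx det_lblock !det1 !mulr1.
have Jr l i : J (rshift N l) i = (rshift N l == i)%:R -
    tvar R ^ (- (other O l).2) * (lshift L (other O l).1 == i)%:R.
  rewrite mxE /p_sigma (unsplitK (inr l) : fintype.split (rshift N l) = inr l).
  rewrite mpoly.mderivB mpoly.mderiv_mulC !mderivXU mpoly.mevalB mpoly.mevalM.
  by rewrite mpoly.mevalC !rmorph_nat.
have dlJ : dlsubmx J = - other_mx.
  apply/matrixP => l m.
  by rewrite 2!mxE Jr eq_rlshift eq_lshift sub0r !mxE mulrC.
have drJ : drsubmx J = 1%:M.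
  apply/matrixP => l m.
  by rewrite 2!mxE Jr eq_rshift eq_lrshift mulr0 subr0 mxE.
rewrite -[J]submxK mulmx_block dlJ drJ !mul1mx !mulmx1 !mulmx0 addNr !add0r.
rewrite det_ublock det1 mulr1.
set M := (\sum_b _).
pose d : 'rV_N := \row_m (Cconst (pt (lshift L m)))^-1.
(* The transpose appears because tetrahedra index the rows of the Jacobian but the columns of G(t);
   [d] collects the denominators c_m of the logarithmic derivatives. *)
suff -> : ulsubmx J + ursubmx J *m other_mx = M^T *m diag_mx d.
  rewrite det_mulmx det_tr mulrC det_diag rmorph_prod -prodfV; congr (_ * _).
  by apply: eq_bigr => m _; rewrite mxE.
have JE j i : J (lshift L j) i = \sum_k \sum_(x <- quad_edges k) Cconst (W j k) *
    ((edge_var O (j, x.1, x.2) == i)%:R /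
     Cconst (pt (lshift L (eidx E (j, x.1, x.2))))).
  rewrite mxE /p_sigma (unsplitK (inl j) : fintype.split (lshift L j) = inl j).
  rewrite ptolemy_lhsE (raddf_sum (mpoly.mderiv i)) (raddf_sum ev) /=.
  by apply: eq_bigr => k _; rewrite eval_deriv_ptolemy_term.
apply/matrixP => j m; rewrite mul_mx_diag.
transitivity (J (lshift L j) (lshift L m) +
              \sum_l J (lshift L j) (rshift N l) * other_mx l m).
  by rewrite !mxE; congr (_ + _); apply: eq_bigr => l _; rewrite !mxE.
transitivity (\sum_k \sum_(x <- quad_edges k)
    Cconst (W j k) / Cconst (pt (lshift L (eidx E (j, x.1, x.2)))) *
    ((eidx E (j, x.1, x.2) == m)%:R * tvar R ^ (- eshift D (j, x.1, x.2)))).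
  under eq_bigr => l _ do rewrite JE mulr_suml.
  rewrite JE exchange_big -big_split; apply: eq_bigr => k _ /=.
  under [X in _ + X]eq_bigr => l _ do rewrite mulr_suml.
  rewrite exchange_big -big_split; apply: eq_big_seq => x /quad_edges_slot sx /=.
  rewrite -edge_var_other_mx // mulrDr mulr_sumr; congr (_ + _); first by ring.
  by apply: eq_bigr => l _; ring.
(* Absolute quad types k become types q_j + b relative to the chosen one, as in [Gt]. *)
rewrite 3!mxE summxE mulr_suml (reindex_inj (addrI (q j))).
apply: eq_bigr => b _; rewrite mul_mx_diag mxE GtE mxE.
rewrite -mulrA mulr_suml [RHS]big_mkcond; apply: eq_bigr => x _ /=.
case: eqP => [->|_]; last by rewrite mul0r mulr0.
by rewrite mul1r mulrC.
Qed.

End Evaluation.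

(** * Products of edge values with flattening exponents *)

Lemma expfz_sum (K : fieldType) (I : Type) (r : seq I) (P : pred I) (x : K)
    (n : I -> int) :
  x != 0 -> \prod_(i <- r | P i) x ^ n i = x ^ (\sum_(i <- r | P i) n i).
Proof.
move=> x0; symmetry.
exact: (big_morph (fun n => x ^ n) (fun m n => expfzDr m n x0) (expr0z x)).
Qed.

Lemma prodfz (K : fieldType) (I : finType) (F : I -> K) (n : int) :
  (\prod_i F i) ^ n = \prod_i F i ^ n.
Proof.
exact: (big_morph (fun x => x ^ n) (fun x y => expfzMl x y n) (exp1rz K n)).
Qed.

(** By [GtE] at t = 1, y_i occurs in the inner product to the power [G E D q b i j]. Its total
    exponent is thus row i of Gf + G'f' + G''f'', which is 2. *)
Lemma flattening_prod (K : fieldType) N (T : triangulation N)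
    (E : edge_labelling T) (D : cover_lifts T) (q : 'I_N -> 'Z_3)
    (f : 'Z_3 -> 'cV[int]_N) (y : 'I_N -> K) :
  flattening E D q f -> (forall i, y i != 0) ->
  \prod_j \prod_b
    (\prod_(x <- quad_edges (q j + b)) y (eidx E (j, x.1, x.2))) ^ f b j 0 =
  \prod_i y i ^+ 2.
Proof.
case=> _ Gf _ y0.
transitivity (\prod_j \prod_b \prod_i y i ^ (G E D q b i j * f b j 0)).
  apply: eq_bigr => j _; apply: eq_bigr => b _.
  under [RHS]eq_bigr => i _ do rewrite -exprz_exp.
  rewrite -prodfz; congr (_ ^ _).
  under [RHS]eq_bigr => i _.
    rewrite /G GtE (eq_bigr (fun=> 1)) => [|x _]; last by rewrite exp1rz.
    rewrite -expfz_sum //.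
    over.
  rewrite (exchange_big_dep predT) //=; apply: eq_bigr => x _.
  by under eq_bigl => i do rewrite eq_sym; rewrite big_pred1_eq expr1z.
under eq_bigr => j _ do rewrite exchange_big.
rewrite exchange_big; apply: eq_bigr => i _ /=.
under eq_bigr => j _ do rewrite expfz_sum //.
rewrite expfz_sum // exchange_big.
have /matrixP/(_ i 0) := Gf; rewrite summxE mxE => Gfi.
rewrite (_ : \sum_b _ = 2%:R) // -Gfi; apply: eq_bigr => b _.
by rewrite mxE.
Qed.

(** The weights are monomials in the y_i only up to sign. Everything is therefore squared,
    [flattening_prod] is applied to the y_i^2, and taking the root costs one global sign. *)
Lemma flattening_weight_prod (K : fieldType) N (T : triangulation N)
    (E : edge_labelling T) (D : cover_lifts T) (q : 'I_N -> 'Z_3)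
    (f : 'Z_3 -> 'cV[int]_N) (w u : 'I_N -> 'Z_3 -> K) (lam y : 'I_N -> K) :
  flattening E D q f -> (forall i, y i != 0) -> (forall j, lam j != 0) ->
  (forall j k, w j k ^+ 2 =
     \prod_(x <- quad_edges k) y (eidx E (j, x.1, x.2)) ^+ 2) ->
  (forall j b, w j (q j + b) = lam j * u j b) ->
  (\prod_j lam j) * \prod_j \prod_b u j b ^ f b j 0 = (\prod_i y i) ^+ 2 \/
  (\prod_j lam j) * \prod_j \prod_b u j b ^ f b j 0 = - (\prod_i y i) ^+ 2.
Proof.
move=> hf y0 lam0 w_sq wE.
suff : ((\prod_j lam j) * \prod_j \prod_b u j b ^ f b j 0) ^+ 2 ==
       ((\prod_i y i) ^+ 2) ^+ 2.
  by rewrite eqf_sqr => /orP[] /eqP; [left|right].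
apply/eqP; rewrite -!prodrXl -(flattening_prod hf) => [|i]; last first.
  by rewrite expf_neq0.
rewrite -big_split -prodrXl; apply: eq_bigr => j _ /=.
transitivity (\prod_b (w j (q j + b) ^+ 2) ^ f b j 0).
  (* The exponent 1 of [lam j] is rewritten as the sum of the [f b j 0], which spreads [lam j] over
     the three factors and recombines each into a weight. *)
  rewrite -{1}[lam j]expr1z.
  have [/matrixP/(_ j 0) + _ _] := hf; rewrite summxE mxE => <-.
  rewrite -expfz_sum // -big_split -prodrXl; apply: eq_bigr => b _ /=.
  by rewrite -expfzMl -wE !exprnP !exprz_exp mulrC.
by apply: eq_bigr => b _; rewrite w_sq.
Qed.

(** * Comparison of the two determinants up to sign *)

Lemma det_sum_scale_cols (K : comPzRingType) N (I : finType)
    (A : I -> 'M[K]_N) (u v : I -> 'I_N -> K) (lam : 'I_N -> K) :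
  (forall b j, v b j = lam j * u b j) ->
  \det (\sum_b A b *m diag_mx (\row_j v b j)) =
  (\prod_j lam j) * \det (\sum_b A b *m diag_mx (\row_j u b j)).
Proof.
move=> vE; rewrite (_ : \sum_b _ =
    (\sum_b A b *m diag_mx (\row_j u b j)) *m diag_mx (\row_j lam j)).
  rewrite det_mulmx det_diag mulrC; congr (_ * _).
  by apply: eq_bigr => j _; rewrite mxE.
rewrite mulmx_suml; apply: eq_bigr => b _; apply/matrixP => i j.
by rewrite !mul_mx_diag !mxE vE mulrA mulrAC.
Qed.

(** Used with P = c_1 ... c_N, x the product of the lambda_j and y the denominator of the torsion.
    One factor 1/P is that of the theorem, the other comes out of the Jacobian; together they cancel
    P^2 = +-xy. *)
Lemma sign_quotient (F K : fieldType) (phi : {rmorphism F -> K}) (P x y : F)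
    (d : K) :
  P != 0 -> x * y = P ^+ 2 \/ x * y = - P ^+ 2 ->
  let rhs := (phi P)^-1 * ((phi P)^-1 * (phi x * d)) in
  d / phi y = rhs \/ d / phi y = - rhs.
Proof.
move=> P0 xy /=.
have y0 : phi y != 0.
  have : x * y != 0 by case: xy => ->; rewrite ?oppr_eq0 expf_neq0.
  by rewrite fmorph_eq0 mulf_eq0 negb_or => /andP[].
have P0' : phi P != 0 by rewrite fmorph_eq0.
have xE s : x * y = s * P ^+ 2 -> phi x = phi s * phi P ^+ 2 / phi y.
  by move=> xys; rewrite -rmorphXn -rmorphM -xys rmorphM mulfK.
case: xy => xy; [left; rewrite (xE 1) ?mul1r // | right].
  by rewrite rmorph1; field; rewrite P0' y0.
by rewrite (xE (-1)) ?mulN1r // rmorphN1; field; rewrite P0' y0.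
Qed.

Theorem theorem3p7 (R : realType) (N : nat) (T : triangulation N)
  (j0 : 'I_N)
  (hM : one_cusped_hyperbolic R T j0)
  (alpha : seq 'I_4 -> int) (halpha : pi1_epi_int T j0 alpha)
  (E : edge_labelling T)
  (D : cover_lifts T) (hD : cover_of j0 alpha D)
  (L : nat) (O : other_edges E D L)
  (q : 'I_N -> 'Z_3)
  (sigma : 'I_N -> 'I_4 -> 'I_4 -> 'I_4 -> int)
  (hsigma : obstruction_cocycle R T j0 sigma)
  (z : 'I_N -> R[i]%C) (hz : geometric_solution j0 E D q z)
  (f : 'Z_3 -> 'cV[int]_N) (hf : flattening E D q f)
  (c : slot N -> R[i]%C) (hc : ptolemy_assignment T sigma c)
  (hcz : has_shapes q sigma c z)
  (pt : 'I_(N + L) -> R[i]%C) (hpt : point_of O c pt) :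
  let rhs := (Cconst (\prod_(i < N) pt (lshift L i)))^-1 *
             jacobian_det sigma O pt in
  tau_CS E D q z f = rhs \/ tau_CS E D q z f = - rhs.
Proof.
move=> rhs; rewrite {}/rhs (jacobian_detE hc hpt q).
pose W j k := ptolemy_term sigma (fun v w => c (j, v, w)) j k.
have [cocycle _] := hsigma.
have [[z01 _ _] _] := hz.
have [c0 _ _ c_eq] := hc.
have W_sq j k : W j k ^+ 2 =
    \prod_(x <- quad_edges k) pt (lshift L (eidx E (j, x.1, x.2))) ^+ 2.
  rewrite exprMn -rmorphXn /= (ptolemy_coef_sign _ _ cocycle) mul1r -prodrXl.
  apply: eq_big_seq => x /quad_edges_slot sx.
  by rewrite (assignment_pt hc hpt) // exprMn sqrr_sign mul1r.
have W0 j k : W j k != 0.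
  rewrite -sqrf_eq0 W_sq prodf_seq_neq0; apply/allP => x _.
  by rewrite expf_neq0 // (pt_neq0 hc hpt).
pose lam j := W j (q j) * z j.
have WE j b : W j (q j + b) = lam j * zeta (z j) b.
  have [z0 z1] := z01 j; apply: (zeta_quad (w := W j)) => //.
    by rewrite -ptolemy_lhsE.
  by rewrite hcz (ptolemy_shapeE _ cocycle).
have lam0 j : lam j != 0 by rewrite mulf_neq0 // (z01 j).1.
have y0 i : pt (lshift L i) != 0 := pt_neq0 hc hpt i.
have LZ := flattening_weight_prod hf y0 lam0 W_sq WE.
(* Column j belongs to tetrahedron j, so replacing its three monomials by the zetas extracts
   lambda_j from that column. *)
have -> := @det_sum_scale_cols _ _ _ (fun b => Gt E D q (tvar R) b)
  (fun b j => Cconst (zeta (z j) b)) (fun b j => Cconst (W j (q j + b)))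
  (fun j => Cconst (lam j)); last by move=> b j; rewrite WE rmorphM.
rewrite /tau_CS -(rmorph_prod (@Cconst R)).
apply: sign_quotient LZ; exact/prodf_neq0.
Qed.
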